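(* For each $(k,n)\in\{(5,10),(6,16),(7,28)\}$ there exists a unit tight equiangular $(k,n)$ frame $G$ with columns $f_1,\dots,f_n\in\mathbb{R}^k$ such that $\Lambda(G)=\mathrm{span}_{\mathbb{Z}}\{f_1,\dots,f_n\}$ is a lattice, i.e. a discrete additive subgroup of $\mathbb{R}^k$.
   Context: For $2\le k<n$, a real $k\times n$ matrix $G$ with columns $f_1,\dots,f_n$ is a unit tight equiangular $(k,n)$ frame if $GG'=\gamma I$ with $\gamma=n/k$, and $G'G=I+(1/\alpha)C$ with $\alpha=\sqrt{k(n-1)/(n-k)}$, where $C$ is an $n\times n$ matrix with zero diagonal and all off-diagonal entries $\pm1$ ($'$ denotes transpose). *)

(* Defs.v *)
From mathcomp Require Import all_boot all_order all_algebra.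
From mathcomp Require Import all_classical all_reals all_analysis.

Set Implicit Arguments.
Unset Strict Implicit.
Unset Printing Implicit Defensive.

Import Order.TTheory GRing.Theory Num.Theory.
Import numFieldNormedType.Exports.

Local Open Scope classical_set_scope.
Local Open Scope ring_scope.

Definition frame_gamma (R : realType) (k n : nat) : R := n%:R / k%:R.

Definition frame_alpha (R : realType) (k n : nat) : R :=
  Num.sqrt (k%:R * (n%:R - 1) / (n%:R - k%:R)).

Definition seidel_mx (R : realType) (n : nat) (C : 'M[R]_n) : Prop :=
  (forall i, C i i = 0) /\
  (forall i j, i != j -> C i j = 1 \/ C i j = -1).

Definition unit_tight_equiangular_frame (R : realType) (k n : nat)
    (G : 'M[R]_(k, n)) : Prop :=
  [/\ (2 <= k < n)%N,
      G *m G^T = (frame_gamma R k n)%:M &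
      exists2 C : 'M[R]_n, seidel_mx C &
        G^T *m G = 1%:M + (frame_alpha R k n)^-1 *: C].

Definition frame_Zspan (R : realType) (k n : nat) (G : 'M[R]_(k, n)) :
    set 'cV[R]_k :=
  [set v | inIntSpan [tuple col j G | j < n] v].

(* Discreteness is with respect to the usual topology of R^k: every point of L
   is isolated in L.  The rank of L is not required to be k. *)
Definition is_lattice (R : realType) (k : nat) (L : set 'cV[R]_k) : Prop :=
  zmod_closed (mem L) /\ L `<=` isolated L.

(* Main.v *)
Require Import Defs.
From mathcomp Require Import all_boot all_order all_algebra.
From mathcomp Require Import all_classical all_reals all_analysis.
From mathcomp Require Import ring.

(** In all three cases [alpha = 3], and the frame is given by integer vectors
    after scaling each coordinate by a square root.  The 16 vectors in R^6 are
    the sign vectors with an even number of minus signs, up to sign; the 28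
    vectors in R^7 are the sign patterns, up to sign, on the seven lines of the
    Fano plane; the 10 vectors in R^5 are the balanced sign vectors of length 6,
    up to sign, in the hyperplane of vectors with zero sum.

    Discreteness only uses that the Gram matrix is rational: if [m (G'G)] is an
    integer matrix, then [m |v|^2] is an integer for every [v] in the integer
    span, so that the nonzero vectors of the span are bounded away from 0. *)

Import Order.TTheory GRing.Theory Num.Theory.
Import numFieldNormedType.Exports.

Section Frames.
Local Open Scope classical_set_scope.
Local Open Scope ring_scope.

Lemma frame_ZspanP (R : realType) (k n : nat) (G : 'M[R]_(k, n)) (v : 'cV[R]_k) :
  frame_Zspan G v <-> exists a : 'cV[int]_n, v = G *m map_mx intr a.
Proof.
have sumE (b : 'I_n -> int) :
    \sum_(j < n) [tuple col j G | j < n]`_j *~ b j =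
    G *m map_mx intr (\col_j b j).
  apply/matrixP => i l; rewrite summxE mxE; apply: eq_bigr => j _.
  rewrite -tnth_nth tnth_mktuple !mxE -scaler_int mxE mulrC.
  by rewrite ord1 mxE.
split=> [[b ->]|[a ->]]; first by exists (\col_j b j); exact: sumE.
exists [ffun j => a j 0]; rewrite sumE; congr (G *m map_mx intr _).
by apply/matrixP => i j; rewrite mxE ffunE ord1.
Qed.

Lemma zmod_closed_frame_Zspan (R : realType) (k n : nat) (G : 'M[R]_(k, n)) :
  zmod_closed (mem (frame_Zspan G)).
Proof.
split=> [|u v].
  by apply/mem_set/frame_ZspanP; exists 0; rewrite map_mx0 mulmx0.
move=> /set_mem/frame_ZspanP[a ->] /set_mem/frame_ZspanP[b ->].
by apply/mem_set/frame_ZspanP; exists (a - b); rewrite map_mxB mulmxBr.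
Qed.

Lemma is_lattice_int_gram (R : realType) (k n m : nat) (G : 'M[R]_(k, n))
    (Z : 'M[int]_n) :
  (0 < m)%N -> m%:R *: (G^T *m G) = map_mx intr Z -> is_lattice (frame_Zspan G).
Proof.
move=> m0 GZ; split; first exact: zmod_closed_frame_Zspan.
move=> v Lv; split; first exact/mem_set.
(* Balls here are entrywise. With radius [e = 1/(mk+1) <= 1], each coordinate of [u = v - w] has
   [u_i^2 <= e], so [m |u|^2 <= mke < 1]. *)
have mk0 : 0 < (m * k).+1%:R^-1 :> R by rewrite invr_gt0.
exists (ball v (m * k).+1%:R^-1); first exact: nbhsx_ballx.
apply/seteqP; split=> [w [/= [_ vw] Lw]|_ ->]; last first.
  by split=> //; exact: ballxx.
have /set_mem/frame_ZspanP[a aE] : v - w \in mem (frame_Zspan G).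
  by apply: (zmod_closed_frame_Zspan _ _ _ G).2; exact/mem_set.
have [u uE] : exists u : 'cV[R]_k, u = v - w by exists (v - w).
rewrite -uE in aE.
have normE : m%:R * \sum_i u i 0 ^+ 2 = ((a^T *m Z *m a) 0 0)%:~R :> R.
  transitivity ((m%:R *: (u^T *m u)) 0 0).
    by rewrite !mxE; congr (_ * _); apply: eq_bigr => i _; rewrite mxE expr2.
  rewrite aE trmx_mul -[X in _ *: X]mulmxA [G^T *m _]mulmxA.
  by rewrite scalemxAr scalemxAl GZ map_trmx -!map_mxM mxE mulmxA.
have sq_ge0 (i : 'I_k) : true -> 0 <= u i 0 ^+ 2 by rewrite sqr_ge0.
have lt1 : m%:R * \sum_i u i 0 ^+ 2 < 1.
  suff : \sum_i u i 0 ^+ 2 <= k%:R * (m * k).+1%:R^-1.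
    move=> /(ler_wpM2l (ler0n R m))/le_lt_trans; apply.
    by rewrite mulrA -natrM ltr_pdivrMr // mul1r ltr_nat.
  have -> : k%:R * (m * k).+1%:R^-1 = \sum_(i < k) (m * k).+1%:R^-1 :> R.
    by rewrite sumr_const card_ord mulr_natl.
  apply: ler_sum => i _; have := vw i 0; rewrite /ball /= => uij.
  have {}uij : `|u i 0| <= (m * k).+1%:R^-1 by rewrite uE !mxE ltW.
  rewrite -real_normK ?num_real// expr2 -[leRHS]mulr1 ler_pM//.
  by apply: le_trans uij _; rewrite invf_le1// ler1n.
have sum0 : \sum_i u i 0 ^+ 2 = 0.
  have : 0 <= m%:R * \sum_i u i 0 ^+ 2 by rewrite mulr_ge0// sumr_ge0.
  move: lt1; rewrite normE ler0z ltrz1 => lt1 ge0.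
  have /eqP : ((a^T *m Z *m a) 0 0)%:~R = 0 :> R.
    by apply/eqP; rewrite intr_eq0 eq_le ge0 andbT -ltzD1 add0r.
  by rewrite -normE mulf_eq0 pnatr_eq0 gtn_eqF//= => /eqP.
have u0 : u = 0.
  apply/matrixP => i j; rewrite ord1 [RHS]mxE; apply/eqP.
  by rewrite -sqrf_eq0; apply/eqP/(psumr_eq0P sq_ge0 sum0).
by apply/esym/eqP; rewrite -subr_eq0 -uE u0.
Qed.

(** A plain fold in place of the locked big operator, so that [vm_compute] can evaluate it. *)
Definition sum_upto (n : nat) (F : nat -> int) : int :=
  foldr (fun i => +%R (F i)) 0 (iota 0 n).

Lemma sum_uptoE (n : nat) (F : nat -> int) : sum_upto n F = \sum_(i < n) F i.
Proof.
by rewrite -(big_mkord xpredT) /sum_upto unlock /index_iota subn0.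
Qed.

(* [c] lists the columns; the frame vectors are obtained by multiplying the
   [i]-th coordinate by [sqrt (w_i / s)]. *)
Definition int_frame (k n a s : nat) (w : seq nat) (c : seq (seq int)) : bool :=
  let e i j := nth 0 (nth [::] c j) i in
  [&& (2 <= k < n)%N, (0 < a)%N, (0 < s)%N, (k * n.-1 == a ^ 2 * (n - k))%N,
    all (fun i => all (fun i' =>
      let p := sum_upto n (fun j => e i j * e i' j) in
      if i == i' then k%:Z * (nth 0%N w i)%:Z * p == (n * s)%N%:Z else p == 0)
      (iota 0 k)) (iota 0 k) &
    all (fun j => all (fun j' =>
      let p := sum_upto k (fun i => (nth 0%N w i)%:Z * (e i j * e i j')) in
      if j == j' then p == s%:Z else (a%:Z * p == s%:Z) || (a%:Z * p == - s%:Z))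
      (iota 0 n)) (iota 0 n)].

Lemma int_frame_lattice (R : realType) (k n a s : nat) (w : seq nat)
    (c : seq (seq int)) :
  int_frame k n a s w c ->
  exists G : 'M[R]_(k, n),
    unit_tight_equiangular_frame G /\ is_lattice (frame_Zspan G).
Proof.
rewrite /int_frame; set e := fun i j => nth 0 (nth [::] c j) i.
case/and5P=> /andP[k2 kn] a0 s0 /eqP kna /andP[/allP rowP /allP colP].
have k0 : (0 < k)%N by apply: leq_trans k2.
have sn0 : s%:R != 0 :> R by rewrite pnatr_eq0 -lt0n.
have kn0 : k%:R != 0 :> R by rewrite pnatr_eq0 -lt0n.
have an0 : a%:R != 0 :> R by rewrite pnatr_eq0 -lt0n.
(* By [kna] the radicand is [a ^ 2]. *)
have alphaE : frame_alpha R k n = a%:R.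
  rewrite /frame_alpha -[n%:R - 1](@natrB R n 1) ?(leq_trans _ kn)//.
  rewrite -natrB ?(ltnW kn)// subn1 -natrM kna natrM mulfK ?natrX.
    by rewrite sqrtr_sqr ger0_norm.
  by rewrite pnatr_eq0 subn_eq0 -ltnNge.
pose r (i : 'I_k) : R := Num.sqrt ((nth 0%N w i)%:R / s%:R).
have r2 i : r i * r i = (nth 0%N w i)%:R / s%:R.
  by rewrite -expr2 sqr_sqrtr// divr_ge0.
pose G : 'M[R]_(k, n) := \matrix_(i, j) (r i * (e i j)%:~R).
pose P : 'M[int]_n :=
  \matrix_(j, j') sum_upto k (fun i => (nth 0%N w i)%:Z * (e i j * e i j')).
have gramE : s%:R *: (G^T *m G) = map_mx intr P.
  apply/matrixP => j j'; rewrite !mxE sum_uptoE mulr_sumr rmorph_sum /=.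
  apply: eq_bigr => i _; rewrite !mxE mulrACA r2 !rmorphM /=.
  by rewrite [_ / _]mulrC !mulrA divff// mul1r.
have gram_ij j j' : (G^T *m G) j j' = (P j j')%:~R / s%:R.
  apply: (mulfI sn0); have := congr1 (fun M : 'M[R]_n => M j j') gramE.
  by rewrite !mxE => ->; rewrite mulrCA divff// mulr1.
exists G; split; last exact: (is_lattice_int_gram _ _ _ _ _ _ s0 gramE).
split; first by rewrite k2.
- apply/matrixP => i i'; rewrite /frame_gamma !mxE.
  have -> : \sum_j G i j * G^T j i' =
      r i * r i' * (sum_upto n (fun j => e i j * e i' j))%:~R.
    rewrite sum_uptoE rmorph_sum mulr_sumr; apply: eq_bigr => j _ /=.
    by rewrite !mxE mulrACA rmorphM.
  have iP (l : 'I_k) : (l : nat) \in iota 0 k by rewrite mem_iota /=.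
  have /allP/(_ _ (iP i')) /= := rowP _ (iP i); rewrite -val_eqE /=.
  (* [r i * r i'] may be irrational for distinct [i], [i'], but there the integer rows are
     orthogonal; only [r i * r i = w_i / s] survives. *)
  have [ii' /eqP pE|ii' /eqP ->] := eqVneq (i : nat) i'; last by rewrite mulr0.
  rewrite -(val_inj ii') in pE *; rewrite r2 mulr1n.
  apply: (mulfI kn0); apply: (mulfI sn0).
  have := congr1 (fun z : int => z%:~R : R) pE.
  rewrite !rmorphM /= -!pmulrn => pE'.
  rewrite [k%:R * (n%:R / _)]mulrCA divff// mulr1 [RHS]mulrC -pE'.
  by field.
(* The Gram equation forces this [C]. *)
- exists (a%:R *: (G^T *m G - 1%:M)); last first.
    by rewrite alphaE scalerA mulVf// scale1r addrC subrK.
  have jP (l : 'I_n) : (l : nat) \in iota 0 n by rewrite mem_iota /=.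
  split=> [j|j j' jj']; rewrite mxE [_ j _]mxE gram_ij [P _ _]mxE.
    have /allP/(_ _ (jP j)) /= := colP _ (jP j); rewrite eqxx => /eqP ->.
    by rewrite divff// !mxE eqxx subrr mulr0.
  have /allP/(_ _ (jP j')) /= := colP _ (jP j).
  rewrite val_eqE (negPf jj') !mxE (negPf jj') oppr0 addr0 mulrA.
  set p := sum_upto _ _ => /orP[] /eqP pE; [left|right];
    have := congr1 (fun z : int => z%:~R : R) pE; rewrite ?rmorphN rmorphM /= => ->;
    by rewrite ?mulNr divff.
Qed.

Fixpoint sign_vectors (m : nat) : seq (seq int) :=
  if m is m'.+1 then
    [seq x :: v | x <- [:: 1; -1], v <- sign_vectors m']
  else [:: [::]].

Definition dot (u v : seq int) : int :=
  foldr (fun p => +%R (p.1 * p.2)) 0 (zip u v).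

(* Coordinates with respect to an orthogonal basis of the zero-sum hyperplane
   of R^6; the weights in the frame undo the squared norms 2, 2, 2, 4, 12. *)
Definition columns5 : seq (seq int) :=
  [seq [seq dot b (1 :: v)
         | b <- [:: [:: 1; -1; 0; 0; 0; 0]; [:: 0; 0; 1; -1; 0; 0];
                    [:: 0; 0; 0; 0; 1; -1]; [:: 1; 1; -1; -1; 0; 0];
                    [:: 1; 1; 1; 1; -2%:Z; -2%:Z]]]
    | v <- sign_vectors 5 & foldr +%R 0 v == -1].

(** The leading 1 picks one vector of each pair [v], [-v]. Two distinct columns differ in 2 or 4
    places, so their inner product is 2 or -2. *)
Definition columns6 : seq (seq int) :=
  [seq 1 :: v | v <- sign_vectors 5 & foldr *%R 1 v == 1].

(* The lines of the Fano plane are the translates of the difference set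
   {0, 1, 3} modulo 7. *)
Definition columns7 : seq (seq int) :=
  [seq [seq nth 0 (1 :: v) (index i [:: d; d.+1 %% 7; d.+3 %% 7]%N)
         | i <- iota 0 7]
    | d <- iota 0 7, v <- sign_vectors 2].

(** The weights are 12 divided by the squared norms of the basis, so the weighted product is 12
    times that of R^6, and [72 = 12 * 6]. Distinct balanced vectors, up to sign, have product 2 or
    -2. *)
Lemma int_frame5 : int_frame 5 10 3 72 [:: 6; 6; 6; 3; 1]%N columns5.
Proof. by vm_compute. Qed.

Lemma int_frame6 : int_frame 6 16 3 6 (nseq 6 1%N) columns6.
Proof. by vm_compute. Qed.

(** Distinct lines meet in one point, and distinct patterns on one line differ in 1 or 2 of 3
    places; both give product 1 or -1. *)
Lemma int_frame7 : int_frame 7 28 3 3 (nseq 7 1%N) columns7.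
Proof. by vm_compute. Qed.

End Frames.

Theorem mainTheorem3 (R : realType) (k n : nat) :
  (k, n) \in [:: (5, 10); (6, 16); (7, 28)] ->
  exists G : 'M[R]_(k, n),
    unit_tight_equiangular_frame G /\ is_lattice (frame_Zspan G).
Proof.
rewrite !inE => /or3P[] /eqP[-> ->].
- exact: int_frame_lattice int_frame5.
- exact: int_frame_lattice int_frame6.
- exact: int_frame_lattice int_frame7.
Qed.
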